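(* Let $\beta>0$ and let $\omega^+(p)=1-p$, $\omega^-(p)=p$ (mean-only normalization). Given policies with $\pi_0=\pi_{\mathrm{ref}}$, write $p_n(q)=\mathbb{P}_{o\sim\pi_n(\cdot|q)}(r(q,o)=1)$, $p_{\mathrm{ref}}(q)=p_0(q)$, and $A_{n-1}(q,o)=\omega^+(p_{n-1}(q))$ if $r(q,o)=1$, $A_{n-1}(q,o)=-\omega^-(p_{n-1}(q))$ if $r(q,o)=0$. (1) (Dr. GRPO, no clipping) If for $n\ge1$, $\pi_n$ maximizes over policies $\pi$ the objective $\mathbb{E}_{q\sim\rho_{\mathcal Q}}\big(\mathbb{E}_{o\sim\pi(\cdot|q)}A_{n-1}(q,o)-\beta\,\mathsf{KL}(\pi(\cdot|q)\|\pi_{\mathrm{ref}}(\cdot|q))\big)$, then for $\rho_{\mathcal Q}$-almost every $q$ and all $n\ge1$, $$\mathrm{logit}(p_n(q))=\mathrm{logit}(p_{\mathrm{ref}}(q))+\frac1\beta,$$ so that the iteration has the constant fixed point $p^*(q)=\sigma\big(\mathrm{logit}(p_{\mathrm{ref}}(q))+\frac1\beta\big)$. (2) (Mirror Dr. GRPO) If for $n\ge1$, $\pi_n$ maximizes over policies $\pi$ the objective $\mathbb{E}_{q\sim\rho_{\mathcal Q}}\big(\mathbb{E}_{o\sim\pi(\cdot|q)}A_{n-1}(q,o)-\beta\,\mathsf{KL}(\pi(\cdot|q)\|\pi_{n-1}(\cdot|q))\big)$, then for $\rho_{\mathcal Q}$-almost every $q$ and all $n\ge1$, $$\mathrm{logit}(p_n(q))=\mathrm{logit}(p_{n-1}(q))+\frac1\beta;$$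 hence $\mathrm{logit}(p_n(q))=\mathrm{logit}(p_{\mathrm{ref}}(q))+\frac n\beta$, and $p_n(q)\uparrow1$ whenever $p_{\mathrm{ref}}(q)\in(0,1)$.
   Context: $\rho_{\mathcal Q}$ is a probability distribution on the prompt space $\mathcal Q$; $\mathcal O$ is the outcome space with a fixed $\sigma$-finite base measure (counting measure when $\mathcal O$ is countable). A policy $\pi$ assigns (measurably) to each $q$ a probability density $\pi(\cdot|q)$ on $\mathcal O$. The reward $r:\mathcal Q\times\mathcal O\to\{0,1\}$ is measurable; $\pi_{\mathrm{ref}}$ is a fixed reference policy. $\mathsf{KL}$ is the Kullback–Leibler divergence, with values in $[0,\infty]$ (the objective is $-\infty$ when the expected divergence is infinite). $\mathrm{logit}(p)=\log\frac{p}{1-p}$ and $\sigma(x)=\frac1{1+e^{-x}}$, with the conventions $\mathrm{logit}(0)=-\infty$, $\mathrm{logit}(1)=+\infty$, $\sigma(-\infty)=0$, $\sigma(+\infty)=1$. *)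

(* Defs.v *)
From HB Require Import structures.
From mathcomp Require Import all_boot all_order all_algebra.
From mathcomp Require Import all_classical all_reals all_analysis.

Set Implicit Arguments.
Unset Strict Implicit.
Unset Printing Implicit Defensive.

Import Order.TTheory GRing.Theory Num.Theory.
Import numFieldNormedType.Exports.

Local Open Scope classical_set_scope.
Local Open Scope ring_scope.

(* [mu] is the base measure on the outcome space; the density
   [density q : O -> R] is normalized for every prompt [q]. *)
Record policy (R : realType) (dQ dO : measure_display)
    (Q : measurableType dQ) (O : measurableType dO)
    (mu : {sigma_finite_measure set O -> \bar R}) := Policy {
  density :> Q -> O -> R ;
  density_measurable :
    measurable_fun [set: Q * O] (fun x : Q * O => density x.1 x.2) ;
  density_ge0 : forall q o, 0 <= density q o ;
  density_int1 : forall q, (\int[mu]_o (density q o)%:E = 1)%E }.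

Arguments policy {R dQ dO} Q {O} mu.

(* The integrand follows the usual conventions 0 log (0 / b) = 0 and
   a log (a / 0) = +oo for a > 0. For probability densities its negative part
   is integrable (a log (a / b) >= a - b), so the integral is well defined; it
   is +oo when f is not absolutely continuous with respect to g. *)
Definition KL (R : realType) (dO : measure_display) (O : measurableType dO)
    (mu : {measure set O -> \bar R}) (f g : O -> R) : \bar R :=
  (\int[mu]_o (if f o == 0%R then 0
               else if g o == 0%R then +oo
               else (f o * ln (f o / g o))%:E))%E.

(* The value is a real number in [0, 1], so taking [fine] loses nothing. *)
Definition success (R : realType) (dQ dO : measure_display)
    (Q : measurableType dQ) (O : measurableType dO)
    (mu : {sigma_finite_measure set O -> \bar R})
    (r : Q -> O -> bool) (pi : policy Q mu) (q : Q) : R :=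
  fine (\int[mu]_(o in [set o | r q o = true]) (pi q o)%:E)%E.

Definition omega_plus (R : realType) (p : R) : R := 1 - p.
Definition omega_minus (R : realType) (p : R) : R := p.

Definition advantage (R : realType) (dQ dO : measure_display)
    (Q : measurableType dQ) (O : measurableType dO)
    (mu : {sigma_finite_measure set O -> \bar R})
    (r : Q -> O -> bool) (old : policy Q mu) (q : Q) (o : O) : R :=
  if r q o then omega_plus (success r old q)
  else - omega_minus (success r old q).

(* The first inner integral lies in [-1, 1], so the integrand of the outer
   integral is bounded above and the objective is a well-defined element of
   [-oo, 1], equal to -oo exactly when the expected divergence is infinite. *)
Definition objective (R : realType) (dQ dO : measure_display)
    (Q : measurableType dQ) (O : measurableType dO) (rho : probability Q R)
    (mu : {sigma_finite_measure set O -> \bar R})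
    (beta : R) (A : Q -> O -> R) (anchor pi : policy Q mu) : \bar R :=
  (\int[rho]_q ((\int[mu]_o (pi q o * A q o)%:E)
                - beta%:E * KL mu (pi q) (anchor q)))%E.

Definition maximizes (T : Type) (R : realType) (J : T -> \bar R) (x : T) : Prop :=
  forall y, (J y <= J x)%E.

(* One update: [new] is optimal for the advantage computed from [old], with
   the divergence penalty taken relative to [anchor]. *)
Definition update (R : realType) (dQ dO : measure_display)
    (Q : measurableType dQ) (O : measurableType dO) (rho : probability Q R)
    (mu : {sigma_finite_measure set O -> \bar R}) (r : Q -> O -> bool)
    (beta : R) (anchor old new : policy Q mu) : Prop :=
  maximizes (objective rho beta (advantage r old) anchor) new.

(* Only meaningful on [0, 1]. *)
Definition logit (R : realType) (p : R) : \bar R :=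
  if p == 0 then -oo%E else if p == 1 then +oo%E else (ln (p / (1 - p)))%:E.

Definition sigma (R : realType) (x : \bar R) : R :=
  match x with
  | EFin r => (1 + expR (- r))^-1
  | EPInf => 1
  | ENInf => 0
  end.

(* Main.v *)
(* The objective is controlled by the Gibbs variational principle: with
   Z = int g e^(A / beta), every density f satisfies
     int f A - beta KL(f || g) <= beta ln Z,
   with equality exactly for the tilted density g e^(A / beta) / Z. Applied for
   each prompt, it bounds the integrand of the objective by beta ln Z(q), and
   the tilted policy attains this bound; since ln Z is bounded, a maximizer
   attains it for almost every prompt, hence agrees there with the tilted
   policy. The advantage equals 1_{r = 1} - p_old, so tilting multiplies the
   odds of success of the anchor by e^(1 / beta), whatever p_old is. *)

Require Import Defs.
From HB Require Import structures.
From mathcomp Require Import all_boot all_order all_algebra.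
From mathcomp Require Import all_classical all_reals all_analysis.
From mathcomp Require Import measurable_realfun ring lra.

Set Implicit Arguments.
Unset Strict Implicit.
Unset Printing Implicit Defensive.

Import Order.TTheory GRing.Theory Num.Theory.
Import numFieldNormedType.Exports.

Local Open Scope classical_set_scope.
Local Open Scope ring_scope.

(** * Integrals of extended-real functions with a one-sided integrable bound *)

Section integral_lemmas.
Local Open Scope ereal_scope.
Context d (T : measurableType d) (R : realType) (mu : {measure set T -> \bar R}).
Implicit Types (f : T -> \bar R) (u : T -> R).

Lemma integrable_ge0_fin u (c : R) : measurable_fun setT u ->
  (forall x, (0 <= u x)%R) -> \int[mu]_x (u x)%:E = c%:E ->
  mu.-integrable setT (EFin \o u).
Proof.
move=> mu_ u0 uc; apply/integrableP; split; first exact/measurable_EFinP.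
under eq_integral do rewrite /= ger0_norm//.
by rewrite uc ltry.
Qed.

(** The positive part of [f] is dominated by that of [u], so only the negative part can have an
    infinite integral. *)
Lemma integrable_or_ninfty f u : measurable_fun setT f ->
  mu.-integrable setT (EFin \o u) -> (forall x, f x <= (u x)%:E) ->
  mu.-integrable setT f \/ \int[mu]_x f x = -oo.
Proof.
move=> mf iu fu.
have fpoo : \int[mu]_x f^\+ x < +oo.
  apply: le_lt_trans (integral_funepos_lt_pinfty measurableT iu).
  apply: ge0_le_integral => //.
  - exact: measurable_funepos.
  - exact: measurable_funepos (measurable_int mu iu).
  - by move=> x _; rewrite !funeposE; exact: le_max2.
have fp_fin : \int[mu]_x f^\+ x \is a fin_num.
  by rewrite ge0_fin_numE// integral_ge0.
have [fnoo|] := ltP (\int[mu]_x f^\- x) +oo.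
  left; apply/integrableP; split => //.
  under eq_integral do rewrite -[`|f _|]/((abse \o f) _) fune_abse.
  rewrite ge0_integralD//; last 2 first.
  - exact: measurable_funepos.
  - exact: measurable_funeneg.
  exact: lte_add_pinfty.
rewrite leye_eq => /eqP fnoo; right.
by rewrite integralE fnoo addeNy// ltNye.
Qed.

Lemma integrable_or_pinfty f u : measurable_fun setT f ->
  mu.-integrable setT (EFin \o u) -> (forall x, (u x)%:E <= f x) ->
  mu.-integrable setT f \/ \int[mu]_x f x = +oo.
Proof.
move=> mf iu uf.
have iNu : mu.-integrable setT (EFin \o (\- u)%R).
  exact: (eq_integrable measurableT (-%E \o (EFin \o u)) _ _ (integrableN iu)).
have mNf : measurable_fun setT (\- f) by exact: measurableT_comp.
have Nfu x : (\- f) x <= ((\- u)%R x)%:E by rewrite EFinN leeN2.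
have [|] := integrable_or_ninfty mNf iNu Nfu.
- move=> /integrableN h; left; apply: (eq_integrable measurableT _ _ _ h) => // x _ /=.
  exact: oppeK.
- move=> h; right.
  (* Moving the sign out of the integral is legitimate because [f^\-] lies below the positive part
     of [- u] and so has a finite integral. *)
  rewrite -[LHS]oppeK -integralN ?h//.
  rewrite fin_num_adde_defl// fin_numN.
  rewrite ge0_fin_numE ?integral_ge0//.
  apply: le_lt_trans (integral_funepos_lt_pinfty measurableT iNu).
  apply: ge0_le_integral => //.
  - exact: measurable_funeneg.
  - exact: measurable_funepos (measurable_int mu iNu).
  - by move=> x _; rewrite funeposE funenegE le_max2//= EFinN leeN2.
Qed.

(** The nonnegative difference [u - f] has integral zero, hence vanishes almost everywhere. The
    inequality of integrals also excludes the value [-oo] for the integral of [f]. *)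
Lemma ae_eq_le_integral f u : measurable_fun setT f ->
  mu.-integrable setT (EFin \o u) -> (forall x, f x <= (u x)%:E) ->
  \int[mu]_x (u x)%:E <= \int[mu]_x f x ->
  {ae mu, forall x, f x = (u x)%:E}.
Proof.
move=> mf iu fu uf.
have ufin : \int[mu]_x (u x)%:E \is a fin_num by exact: integrable_fin_num.
have [intf|foo] := integrable_or_ninfty mf iu fu; last first.
  by move: uf; rewrite foo leeNy_eq => /eqP u_oo; rewrite u_oo in ufin.
have uf0 x : 0 <= (u x)%:E - f x by rewrite subre_ge0.
have : \int[mu]_x ((u x)%:E - f x) = 0.
  rewrite (integralB _ iu intf)//.
  apply/eqP; rewrite sube_eq ?add0e ?fin_num_adde_defr// eq_le uf/=.
  by apply: le_integral => // x _; exact: fu.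
rewrite (_ : (fun _ => _) = (fun x => `|(u x)%:E - f x|)); last first.
  by apply/funext => x; rewrite gee0_abs.
move=> /ae_eq_integral_abs => /(_ measurableT) [].
  by apply: emeasurable_funB => //; exact: (measurable_int mu iu).
move=> N [mN N0 sN]; exists N; split => // x /= fux; apply: sN => /= h.
apply: fux; move: (h I) (fu x).
by case: (f x) => //= y [] /eqP; rewrite subr_eq0 => /eqP ->.
Qed.

End integral_lemmas.

(** * The Gibbs variational principle for densities *)

Section gibbs_variational_principle.
Context (R : realType).

(** The integrand of [KL], kept convertible to it, so that estimates can be made pointwise. *)
Definition kl_term (a b : R) : \bar R :=
  if a == 0 then 0%E else if b == 0 then +oo%E else (a * ln (a / b))%:E.

(* This is e^y >= 1 + y at y = t - ln (a / b), multiplied by a; the equality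
   case y = 0 is [kl_term_eq]. *)
Lemma kl_term_ge (a b t : R) : 0 <= a -> 0 <= b ->
  ((a * t + a - b * expR t)%:E <= kl_term a b)%E.
Proof.
move=> a0 b0; rewrite /kl_term; have [->|an0] := eqVneq a 0.
  by rewrite lee_fin mul0r !add0r oppr_le0 mulr_ge0 ?expR_ge0.
have [->|bn0] := eqVneq b 0; first by rewrite leey.
have agt0 : 0 < a by rewrite lt_neqAle eq_sym an0.
have bgt0 : 0 < b by rewrite lt_neqAle eq_sym bn0.
have := expR_ge1Dx (t - ln (a / b)).
rewrite expRD expRN lnK ?posrE ?divr_gt0// => /(ler_wpM2l a0).
rewrite (_ : a * (expR t / (a / b)) = b * expR t); last by field; apply/andP.
by rewrite lee_fin; lra.
Qed.

Lemma kl_term_eq (a b t : R) : 0 <= a -> 0 <= b ->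
  kl_term a b = (a * t + a - b * expR t)%:E -> a = b * expR t.
Proof.
move=> a0 b0; rewrite /kl_term; have [->|an0] := eqVneq a 0.
  by rewrite mul0r !add0r => -[] /eqP; rewrite eq_sym oppr_eq0 => /eqP.
have [//|bn0] := eqVneq b 0.
have agt0 : 0 < a by rewrite lt_neqAle eq_sym an0.
have bgt0 : 0 < b by rewrite lt_neqAle eq_sym bn0.
have [tE|tne] := eqVneq (t - ln (a / b)) 0.
  move=> _; move/eqP : tE; rewrite subr_eq0 => /eqP ->.
  by rewrite lnK ?posrE ?divr_gt0//; field.
have := expR_gt1Dx tne.
rewrite expRD expRN lnK ?posrE ?divr_gt0// -(ltr_pM2l agt0).
rewrite (_ : a * (expR t / (a / b)) = b * expR t); last by field; apply/andP.
by move=> + [] => /[swap]; lra.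
Qed.

Lemma kl_term_tilt (b t : R) : 0 <= b ->
  kl_term (b * expR t) b = (b * expR t * t)%:E.
Proof.
rewrite le_eqVlt /kl_term => /predU1P[<-|b0]; first by rewrite !mul0r eqxx.
rewrite !gt_eqF ?mulr_gt0 ?expR_gt0// (mulrC b) mulfK ?gt_eqF//.
by rewrite expRK.
Qed.

Lemma measurable_kl_term d (T : measurableType d) (f g : T -> R) :
  measurable_fun setT f -> measurable_fun setT g ->
  (forall x, 0 <= f x) -> (forall x, 0 <= g x) ->
  measurable_fun setT (fun x => kl_term (f x) (g x)).
Proof.
move=> mf mg f0 g0.
(* The logarithm of the quotient becomes a difference of logarithms, measurable term by term; the
   two earlier branches leave only positive arguments. *)
rewrite (_ : (fun _ => _) = (fun x => if f x == 0 then 0%E else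
    if g x == 0 then +oo%E else (f x * (ln (f x) - ln (g x)))%:E)); last first.
  apply/funext => x; rewrite /kl_term.
  have [//|fx] := eqVneq (f x) 0; have [//|gx] := eqVneq (g x) 0.
  by rewrite ln_div ?posrE// lt_neqAle eq_sym ?fx ?gx ?f0 ?g0.
apply: measurable_fun_ifT => //.
  by apply: measurable_fun_eqr.
apply: measurable_fun_ifT => //; first by apply: measurable_fun_eqr.
apply/measurable_EFinP; apply: measurable_funM => //.
by apply: measurable_funB; apply: measurableT_comp.
Qed.

Context d (T : measurableType d) (mu : {measure set T -> \bar R}).
Variables (beta M Z : R) (f g A : T -> R).
Hypotheses (beta_gt0 : 0 < beta) (Z_gt0 : 0 < Z).
Hypotheses (mf : measurable_fun setT f) (mg : measurable_fun setT g).
Hypothesis mA : measurable_fun setT A.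
Hypotheses (f_ge0 : forall x, 0 <= f x) (g_ge0 : forall x, 0 <= g x).
Hypothesis AM : forall x, `|A x| <= M.
Hypothesis intf : (\int[mu]_x (f x)%:E = 1)%E.
Hypothesis intgA : (\int[mu]_x (g x * expR (A x / beta))%:E = Z%:E)%E.

Definition tilt x := g x * expR (A x / beta) / Z.

(** With the normalization moved into the exponent, [tilt] takes the form [b * expR t] to which the
    [kl_term] lemmas apply. *)
Lemma tiltE x : tilt x = g x * expR (A x / beta - ln Z).
Proof. by rewrite expRD expRN lnK ?posrE// mulrA. Qed.

Lemma measurable_gexp : measurable_fun setT (fun x => g x * expR (A x / beta)).
Proof.
apply: measurable_funM => //; apply: measurableT_comp => //.
exact: measurable_funM.
Qed.

Lemma measurable_tilt : measurable_fun setT tilt.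
Proof. by apply: measurable_funM => //; exact: measurable_gexp. Qed.

Lemma integral_tilt : (\int[mu]_x (tilt x)%:E = 1)%E.
Proof.
rewrite /tilt; under eq_integral do rewrite mulrC EFinM.
rewrite integralZl//; last first.
  apply: integrable_ge0_fin intgA; first exact: measurable_gexp.
  by move=> x; rewrite mulr_ge0 ?expR_ge0.
by rewrite intgA -EFinM mulVf ?gt_eqF.
Qed.

Let integrable_f : mu.-integrable setT (EFin \o f).
Proof. exact: integrable_ge0_fin intf. Qed.

Let integrable_tilt : mu.-integrable setT (EFin \o tilt).
Proof.
apply: (@integrable_ge0_fin _ _ _ _ _ 1) => //; last exact: integral_tilt.
  exact: measurable_tilt.
by move=> x; rewrite tiltE mulr_ge0 ?expR_ge0.
Qed.

Lemma integrable_mul_bounded (h : T -> R) : mu.-integrable setT (EFin \o h) ->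
  mu.-integrable setT (fun x => (h x * A x)%:E).
Proof.
move=> ih; have mh : measurable_fun setT h.
  by apply/measurable_EFinP; exact: (measurable_int mu ih).
apply: (le_integrable measurableT _ _ (integrableZl measurableT M ih)).
  by apply/measurable_EFinP; exact: measurable_funM.
move=> x _; rewrite lee_fin !normrM mulrC ler_wpM2r//.
by rewrite (le_trans (AM x))// ler_norm.
Qed.

(** The integrand is the minorant of [kl_term (f x) (g x)] given by [kl_term_ge] at
    [t = A x / beta - ln Z], where [b * expR t] is [tilt x]. *)
Let integrable_lower : mu.-integrable setT
  (EFin \o (fun x => f x * (A x / beta - ln Z) + f x - tilt x)).
Proof.
have := integrableD measurableT
  (integrableZl measurableT beta^-1 (integrable_mul_bounded integrable_f))
  (integrableB measurableT (integrableZl measurableT (1 - ln Z) integrable_f)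
     integrable_tilt).
apply: eq_integrable => // x _ /=; rewrite -!EFinM -EFinB -EFinD; congr EFin.
by ring.
Qed.

Let KLE : (KL mu f g = \int[mu]_x kl_term (f x) (g x))%E.
Proof. by []. Qed.

(* [lower] integrates to a finite value, namely the one for which
   int f A - beta * int lower = beta * ln Z. *)
Let lower x : R := f x * (A x / beta - ln Z) + f x - tilt x.

Let lower_le x : ((lower x)%:E <= kl_term (f x) (g x))%E.
Proof. by rewrite /lower tiltE; exact: kl_term_ge. Qed.

(** Since [f] and [tilt] both have total mass 1, the part [f - tilt] integrates to zero. *)
Let integral_lower : (\int[mu]_x (lower x)%:E =
  (beta^-1)%:E * \int[mu]_x (f x * A x)%:E - (ln Z)%:E)%E.
Proof.
have ifA := integrable_mul_bounded integrable_f.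
transitivity (\int[mu]_x ((beta^-1)%:E * (f x * A x)%:E +
    ((1 - ln Z)%:E * (f x)%:E - (tilt x)%:E)))%E.
  apply: eq_integral => x _; rewrite -!EFinM -EFinB -EFinD; congr EFin.
  by rewrite /lower; ring.
rewrite integralD//; last 2 first.
- exact: integrableZl.
- by apply: integrableB => //; exact: integrableZl.
rewrite integralB//; last exact: integrableZl.
rewrite !integralZl// intf integral_tilt mule1 -EFinB; congr (_ + _%:E)%E.
by ring.
Qed.

(** This writes the objective as the Gibbs bound minus [beta] times the gap between the divergence
    and its minorant: the sign of the gap gives [gibbs_le], its vanishing gives [gibbs_eq]. *)
Let objective_integrable :
  mu.-integrable setT (fun x => kl_term (f x) (g x)) ->
  (\int[mu]_x (f x * A x)%:E - beta%:E * KL mu f g =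
   (beta * ln Z)%:E -
   beta%:E * (\int[mu]_x kl_term (f x) (g x) - \int[mu]_x (lower x)%:E))%E.
Proof.
move=> iK; rewrite integral_lower KLE.
have /fineK <- := integrable_fin_num measurableT iK.
have /fineK <- :=
  integrable_fin_num measurableT (integrable_mul_bounded integrable_f).
rewrite -?(EFinM, EFinB); congr EFin.
by field; rewrite gt_eqF.
Qed.

Let objective_pinfty : (\int[mu]_x kl_term (f x) (g x) = +oo)%E ->
  (\int[mu]_x (f x * A x)%:E - beta%:E * KL mu f g = -oo)%E.
Proof.
move=> Koo; rewrite KLE Koo gt0_muley ?lte_fin//.
have /fineK <- :=
  integrable_fin_num measurableT (integrable_mul_bounded integrable_f).
by [].
Qed.

(** The integrable minorant [lower] controls the negative part, so the divergence can only be
    infinite upwards. *)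
Let kl_dichotomy : mu.-integrable setT (fun x => kl_term (f x) (g x)) \/
  (\int[mu]_x kl_term (f x) (g x) = +oo)%E.
Proof.
exact: (integrable_or_pinfty (measurable_kl_term mf mg f_ge0 g_ge0)
  integrable_lower lower_le).
Qed.

Lemma gibbs_le :
  (\int[mu]_x (f x * A x)%:E - beta%:E * KL mu f g <= (beta * ln Z)%:E)%E.
Proof.
have [iK|Koo] := kl_dichotomy; last by rewrite objective_pinfty ?leNye.
rewrite objective_integrable// -[leRHS]sube0; apply: leeB => //.
apply: mule_ge0; first by rewrite lee_fin ltW.
rewrite sube_ge0; last first.
  by rewrite (integrable_fin_num measurableT iK) orbT.
by apply: le_integral => // x _; exact: lower_le.
Qed.

(** Equality closes the gap, so the ordered functions [lower] and [kl_term] agree almost everywhere;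
    the equality case of the exponential inequality then identifies [f] with [tilt]. *)
Lemma gibbs_eq :
  (\int[mu]_x (f x * A x)%:E - beta%:E * KL mu f g = (beta * ln Z)%:E)%E ->
  {ae mu, forall x, f x = tilt x}.
Proof.
have [iK|Koo] := kl_dichotomy; last by rewrite objective_pinfty.
rewrite objective_integrable// => eqZ.
have Kl : (\int[mu]_x kl_term (f x) (g x) = \int[mu]_x (lower x)%:E)%E.
  move: eqZ.
  have /fineK <- := integrable_fin_num measurableT iK.
  have /fineK <- := integrable_fin_num measurableT integrable_lower.
  rewrite -!(EFinM, EFinB) => -[] /eqP.
  rewrite -subr_eq0 addrAC subrr add0r oppr_eq0 mulf_eq0 gt_eqF//= subr_eq0.
  by move=> /eqP ->.
have mK := measurable_kl_term mf mg f_ge0 g_ge0.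
(* Signs are reversed because the comparison lemma expects an integrable upper bound, whereas
   [lower] is a lower one. *)
have [||||N [mN N0 sN]] := @ae_eq_le_integral _ T R mu
    (fun x => - kl_term (f x) (g x))%E (\- lower)%R.
- exact: measurableT_comp mK.
- exact: (eq_integrable measurableT _ _ _ (integrableN integrable_lower)).
- by move=> x; rewrite EFinN leeN2 lower_le.
- under eq_integral do rewrite EFinN.
  rewrite !integralN ?Kl//; apply: integrable_add_def => //.
exists N; split => // x /= ne; apply: sN => /= /eqP.
rewrite EFinN eqe_opp => /eqP; rewrite /lower tiltE.
by move=> /(kl_term_eq (f_ge0 x) (g_ge0 x)); rewrite -tiltE.
Qed.

(** At the tilted density [kl_term_tilt] evaluates the divergence exactly, as the mean of the
    exponent [A / beta - ln Z]. *)
Lemma gibbs_tilt :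
  (\int[mu]_x (tilt x * A x)%:E - beta%:E * KL mu tilt g = (beta * ln Z)%:E)%E.
Proof.
have itA := integrable_mul_bounded integrable_tilt.
have -> : (KL mu tilt g =
    (beta^-1)%:E * \int[mu]_x (tilt x * A x)%:E - (ln Z)%:E)%E.
  transitivity (\int[mu]_x ((beta^-1)%:E * (tilt x * A x)%:E -
      (ln Z)%:E * (tilt x)%:E))%E.
    apply: eq_integral => x _; rewrite -[LHS]/(kl_term (tilt x) (g x)) tiltE.
    by rewrite kl_term_tilt// -!EFinM -EFinB; congr EFin; ring.
  rewrite integralB//; [|exact: integrableZl|exact: integrableZl].
  by rewrite !integralZl// integral_tilt mule1.
have /fineK <- := integrable_fin_num measurableT itA.
by rewrite -?(EFinM, EFinB); congr EFin; field; rewrite gt_eqF.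
Qed.

End gibbs_variational_principle.

(** * Success probabilities and measurability in the prompt *)

Section success_probability.
Context (R : realType) (dQ dO : measure_display).
Context (Q : measurableType dQ) (O : measurableType dO).
Context (mu : {sigma_finite_measure set O -> \bar R}).
Variable r : Q -> O -> bool.
Hypothesis mr : measurable_fun [set: Q * O] (fun x : Q * O => r x.1 x.2).
Implicit Types pi : policy Q mu.

Lemma measurable_reward : measurable_fun setT (fun x : Q * O => (r x.1 x.2)%:R : R).
Proof.
rewrite (_ : (fun _ => _) = (fun x : Q * O => if r x.1 x.2 then 1 else 0 : R)).
  by apply: measurable_fun_ifT.
by apply/funext => x; case: (r _ _).
Qed.

Lemma integrable_density pi q : mu.-integrable setT (fun o => (pi q o)%:E).
Proof.
apply: (integrable_ge0_fin _ _ (density_int1 pi q)).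
- exact: (measurable_fun_pair2 q (density_measurable pi)).
- exact: density_ge0.
Qed.

Lemma integrable_success pi q :
  mu.-integrable setT (fun o => (pi q o * (r q o)%:R)%:E).
Proof.
apply: le_integrable (integrable_density pi q) => //.
  apply/measurable_EFinP; apply: measurable_funM.
    exact: (measurable_fun_pair2 q (density_measurable pi)).
  exact: (measurable_fun_pair2 q measurable_reward).
move=> o _; rewrite lee_fin normrM ler_piMr// ger0_norm ?ler0n//.
by case: (r q o).
Qed.

(** Replacing the prompt-dependent domain by an indicator factor gives access to linearity and to
    Tonelli's theorem. *)
Lemma success_integral pi q :
  (\int[mu]_o (pi q o * (r q o)%:R)%:E = (success r pi q)%:E)%E.
Proof.
rewrite /success [in RHS]integral_mkcond.
rewrite (_ : _ \_ _ = fun o => (pi q o * (r q o)%:R)%:E); last first.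
  apply/funext => o; rewrite /patch.
  rewrite (_ : (o \in _) = r q o); last by apply/idP/idP => [/set_mem//|h]; exact: mem_set.
  by case: (r q o); rewrite ?mulr1 ?mulr0.
rewrite fineK//; apply: integrable_fin_num => //; exact: integrable_success.
Qed.

Lemma success_ge0 pi q : 0 <= success r pi q.
Proof.
rewrite -lee_fin -success_integral; apply: integral_ge0 => o _.
by rewrite lee_fin mulr_ge0// density_ge0.
Qed.

Lemma success_le1 pi q : success r pi q <= 1.
Proof.
rewrite -lee_fin -success_integral -(density_int1 pi q).
apply: le_integral => //; [exact: integrable_success|exact: integrable_density|].
move=> o _; rewrite lee_fin ler_piMr ?density_ge0//.
by case: (r q o).
Qed.

Lemma measurable_success pi : measurable_fun setT (success r pi).
Proof.
apply/measurable_EFinP.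
rewrite (_ : _ \o _ = fun q => \int[mu]_o (pi q o * (r q o)%:R)%:E)%E; last first.
  by apply/funext => q; rewrite success_integral.
apply: (measurable_fun_fubini_tonelli_F
  (fun x : Q * O => (pi x.1 x.2 * (r x.1 x.2)%:R)%:E)).
- apply/measurable_EFinP; apply: measurable_funM.
  + exact: density_measurable.
  + exact: measurable_reward.
- by move=> x; rewrite lee_fin mulr_ge0// density_ge0.
Qed.

Lemma measurable_KL (pi anchor : policy Q mu) :
  measurable_fun setT (fun q => KL mu (pi q) (anchor q)).
Proof.
pose K (x : Q * O) := kl_term (pi x.1 x.2) (anchor x.1 x.2).
have mK : measurable_fun setT K.
  apply: measurable_kl_term => [||x|x].
  - exact: density_measurable.
  - exact: density_measurable.
  - exact: density_ge0.
  - exact: density_ge0.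
(* The integrand is signed, so Tonelli's theorem is applied to its positive and negative parts
   separately. *)
rewrite (_ : (fun _ => _) = (fun q => (\int[mu]_o K^\+ (q, o)) -
   (\int[mu]_o K^\- (q, o)))%E); last first.
  apply/funext => q; rewrite /KL integralE.
  by congr (_ - _)%E; apply: eq_integral => o _; rewrite ?funeposE ?funenegE.
apply: emeasurable_funB.
- exact: (measurable_fun_fubini_tonelli_F _ (measurable_funepos mK)).
- exact: (measurable_fun_fubini_tonelli_F _ (measurable_funeneg mK)).
Qed.

Lemma advantageE pi q o : advantage r pi q o = (r q o)%:R - success r pi q.
Proof. by rewrite /advantage; case: (r q o); rewrite // sub0r. Qed.

Lemma measurable_advantage pi :
  measurable_fun setT (fun x : Q * O => advantage r pi x.1 x.2).
Proof.
rewrite (_ : (fun _ => _) =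
  (fun x => (r x.1 x.2)%:R - success r pi x.1)); last first.
  by apply/funext => x; rewrite advantageE.
apply: measurable_funB; first exact: measurable_reward.
apply: measurableT_comp => //; exact: measurable_success.
Qed.

Lemma advantage_le1 pi q o : `|advantage r pi q o| <= 1.
Proof.
have := success_ge0 pi q; have := success_le1 pi q.
by rewrite advantageE ler_norml => *; case: (r q o) => /=; lra.
Qed.

Lemma integral_advantage (pi old : policy Q mu) q :
  (\int[mu]_o (pi q o * advantage r old q o)%:E =
   (success r pi q - success r old q)%:E)%E.
Proof.
under eq_integral do
  rewrite advantageE mulrBr EFinB (mulrC _ (success _ _ _)) (EFinM (success _ _ _)).
rewrite integralB//; last 2 first.
- exact: integrable_success.
- by apply: integrableZl => //; exact: integrable_density.
rewrite integralZl//; last exact: integrable_density.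
by rewrite success_integral density_int1 mule1 EFinB.
Qed.

End success_probability.

(** * The tilted policy and optimality prompt by prompt *)

Section tilted_policy.
Context (R : realType) (dQ dO : measure_display).
Context (Q : measurableType dQ) (O : measurableType dO).
Context (rho : probability Q R) (mu : {sigma_finite_measure set O -> \bar R}).
Variables (r : Q -> O -> bool) (beta : R).
Hypothesis mr : measurable_fun [set: Q * O] (fun x : Q * O => r x.1 x.2).
Hypothesis beta_gt0 : 0 < beta.
Variables anchor old : policy Q mu.

Definition weight (b : bool) q : R :=
  expR ((b%:R - success r old q) / beta).

(** The normalizing constant of the tilt in closed form: the mean under [anchor] of a factor that
    depends on the outcome only through its reward. *)
Definition partition q : R :=
  success r anchor q * weight true q + (1 - success r anchor q) * weight false q.

Lemma weight_gt0 b q : 0 < weight b q. Proof. exact: expR_gt0. Qed.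

Lemma partition_gt0 q : 0 < partition q.
Proof.
rewrite /partition; have := success_ge0 mr anchor q.
have := success_le1 mr anchor q => s1 s0.
(* One of the two coefficients is at least 1/2; splitting there exhibits a strictly positive
   summand. *)
have [sh|sh] := leP (success r anchor q) (1 / 2).
  apply: ltr_wpDl; first by rewrite mulr_ge0// ltW// weight_gt0.
  by rewrite mulr_gt0 ?weight_gt0//; lra.
apply: ltr_wpDr; first by rewrite mulr_ge0 ?(ltW (weight_gt0 _ _))//; lra.
by rewrite mulr_gt0 ?weight_gt0//; lra.
Qed.

Lemma weightE q o : expR (advantage r old q o / beta) = weight (r q o) q.
Proof. by rewrite advantageE. Qed.

Lemma integral_weight q :
  (\int[mu]_o (anchor q o * expR (advantage r old q o / beta))%:E =
   (partition q)%:E)%E.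
Proof.
have is1 := integrable_success mr anchor q.
have id1 := integrable_density anchor q.
(* A function of one bit is affine in its indicator, which reduces the integral to the success
   probability and the total mass. *)
transitivity (\int[mu]_o ((weight true q - weight false q)%:E *
    (anchor q o * (r q o)%:R)%:E + (weight false q)%:E * (anchor q o)%:E))%E.
  apply: eq_integral => o _; rewrite weightE -!EFinM -EFinD; congr EFin.
  by case: (r q o); rewrite ?mulr1 ?mulr0; ring.
rewrite integralD//; [|exact: integrableZl|exact: integrableZl].
rewrite !integralZl// success_integral// density_int1 -!EFinM -EFinD.
by congr EFin; rewrite /partition; ring.
Qed.

Lemma bound_weight q b : expR (- beta^-1) <= weight b q <= expR beta^-1.
Proof.
have s1 := success_le1 mr old q; have s0 := success_ge0 mr old q.
rewrite /weight !ler_expR -[leLHS]mulN1r -[X in _ && (_ <= X)]mul1r.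
by rewrite !ler_pM2r ?invr_gt0//; case: b => /=; lra.
Qed.

(** [partition q] is a convex combination of weights and inherits their bounds; this makes the Gibbs
    bound integrable under [rho]. *)
Lemma ln_partition_bounded q : `|ln (partition q)| <= beta^-1.
Proof.
have s1 := success_le1 mr anchor q; have s0 := success_ge0 mr anchor q.
have /andP[t1 t2] := bound_weight q true.
have /andP[f1 f2] := bound_weight q false.
rewrite ler_norml -ler_expR -(ler_expR (ln _)) lnK ?posrE ?partition_gt0//.
by rewrite /partition; nra.
Qed.

Lemma measurable_ln_partition : measurable_fun setT (fun q => ln (partition q)).
Proof.
have msucc p := measurable_success mr p.
have mw b : measurable_fun setT (weight b).
  apply: measurableT_comp => //; apply: measurable_funM => //.
  exact: measurable_funB.
apply: measurableT_comp => //; apply: measurable_funD.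
  exact: measurable_funM.
by apply: measurable_funM => //; exact: measurable_funB.
Qed.

Definition tilted_density q : O -> R :=
  tilt beta (partition q) (anchor q) (advantage r old q).

(* Division by the partition function is absorbed into the exponential, whose
   measurability is available in the library, unlike that of the inverse. *)
Lemma measurable_tilted_density :
  measurable_fun setT (fun x : Q * O => tilted_density x.1 x.2).
Proof.
rewrite (_ : (fun _ => _) = (fun x => anchor x.1 x.2 *
    expR (advantage r old x.1 x.2 / beta - ln (partition x.1)))); last first.
  by apply/funext => x; rewrite /tilted_density tiltE ?partition_gt0.
apply: measurable_funM; first exact: density_measurable.
apply: measurableT_comp => //; apply: measurable_funB.
  by apply: measurable_funM => //; exact: measurable_advantage.
exact: (measurableT_comp measurable_ln_partition measurable_fst).
Qed.

Lemma measurable_density (pi : policy Q mu) q : measurable_fun setT (pi q).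
Proof. exact: (measurable_fun_pair2 q (density_measurable pi)). Qed.

Lemma measurable_advantage_section q : measurable_fun setT (advantage r old q).
Proof. exact: (measurable_fun_pair2 q (measurable_advantage mr old)). Qed.

Lemma tilted_density_ge0 q o : 0 <= tilted_density q o.
Proof.
rewrite /tilted_density tiltE ?partition_gt0//.
by rewrite mulr_ge0 ?expR_ge0 ?density_ge0.
Qed.

Lemma tilted_density_int1 q : (\int[mu]_o (tilted_density q o)%:E = 1)%E.
Proof.
apply: integral_tilt; last exact: integral_weight.
- exact: partition_gt0.
- exact: measurable_density.
- exact: measurable_advantage_section.
- exact: density_ge0.
Qed.

(** The competitor that attains the Gibbs bound at every prompt; optimality is tested against
    policies only, hence the joint measurability proved above. *)
Definition tilted : policy Q mu :=
  Policy measurable_tilted_density tilted_density_ge0 tilted_density_int1.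

Lemma success_tilted q :
  success r tilted q = success r anchor q * weight true q / partition q.
Proof.
apply: EFin_inj; rewrite -success_integral//.
transitivity (\int[mu]_o ((weight true q / partition q)%:E *
    (anchor q o * (r q o)%:R)%:E))%E.
  apply: eq_integral => o _; rewrite -EFinM; congr EFin.
  rewrite /= /tilted_density /tilt weightE.
  by case: (r q o); rewrite ?mulr1 ?mulr0//; ring.
rewrite integralZl//; last exact: integrable_success.
by rewrite success_integral// -EFinM; congr EFin; ring.
Qed.

Let gain (pi : policy Q mu) q : \bar R :=
  (\int[mu]_o (pi q o * advantage r old q o)%:E
   - beta%:E * KL mu (pi q) (anchor q))%E.

Lemma gain_le pi q : (gain pi q <= (beta * ln (partition q))%:E)%E.
Proof.
apply: (@gibbs_le _ _ _ _ beta 1 _ _ _ (advantage r old q)) => //.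
- exact: partition_gt0.
- exact: measurable_density.
- exact: measurable_density.
- exact: measurable_advantage_section.
- exact: density_ge0.
- exact: density_ge0.
- by move=> o; exact: advantage_le1.
- exact: density_int1.
- exact: integral_weight.
Qed.

Lemma gain_eq pi q : gain pi q = (beta * ln (partition q))%:E ->
  {ae mu, forall o, pi q o = tilted q o}.
Proof.
apply: (@gibbs_eq _ _ _ _ beta 1 _ _ _ (advantage r old q)) => //.
- exact: partition_gt0.
- exact: measurable_density.
- exact: measurable_density.
- exact: measurable_advantage_section.
- exact: density_ge0.
- exact: density_ge0.
- by move=> o; exact: advantage_le1.
- exact: density_int1.
- exact: integral_weight.
Qed.

Lemma gain_tilted q : gain tilted q = (beta * ln (partition q))%:E.
Proof.
apply: (@gibbs_tilt _ _ _ _ beta 1) => //.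
- exact: partition_gt0.
- exact: measurable_density.
- exact: measurable_advantage_section.
- exact: density_ge0.
- by move=> o; exact: advantage_le1.
- exact: integral_weight.
Qed.

Lemma measurable_gain pi : measurable_fun setT (gain pi).
Proof.
apply: emeasurable_funB.
  under eq_fun do rewrite integral_advantage//.
  by apply/measurable_EFinP; apply: measurable_funB; exact: measurable_success.
apply: measurable_funeM; exact: measurable_KL.
Qed.

Lemma integrable_ln_partition :
  rho.-integrable setT (EFin \o (fun q => beta * ln (partition q))).
Proof.
(* The dominating constant is 1, since [beta * beta^-1 = 1]. *)
apply: (@le_integrable _ _ _ rho _ measurableT _ (cst 1%E)).
- apply/measurable_EFinP; apply: measurable_funM => //.
  exact: measurable_ln_partition.
- move=> q _; rewrite lee_fin normr1 normrM gtr0_norm//.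
  by rewrite mulrC -ler_pdivlMr// mul1r ln_partition_bounded.
- exact: finite_measure_integrable_cst.
Qed.

Lemma success_ae_eq (pi pi' : policy Q mu) q :
  {ae mu, forall o, pi q o = pi' q o} -> success r pi q = success r pi' q.
Proof.
move=> h; apply: EFin_inj; rewrite -!success_integral//.
apply: ae_eq_integral => //.
- exact: (measurable_int mu (integrable_success mr pi q)).
- exact: (measurable_int mu (integrable_success mr pi' q)).
- by apply: filterS h => o -> _.
Qed.

Lemma success_update new : update rho r beta anchor old new ->
  {ae rho, forall q, success r new q = success r tilted q}.
Proof.
move=> /(_ tilted) opt.
have : {ae rho, forall q, gain new q = (beta * ln (partition q))%:E}.
  apply: ae_eq_le_integral.
  - exact: measurable_gain.
  - exact: integrable_ln_partition.
  - exact: gain_le.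
  (* With the Gibbs bound rewritten as the gain of [tilted], the required inequality of integrals is
     optimality against this one competitor. *)
  - under eq_integral do rewrite -gain_tilted.
    exact: opt.
by apply: filterS => q /gain_eq; exact: success_ae_eq.
Qed.

End tilted_policy.

(** * Logit calculus and convergence to 1 *)

Section logit.
Context (R : realType).
Implicit Types (p s u v c : R).

Lemma logit_fin p : 0 < p < 1 -> logit p = (ln (p / (1 - p)))%:E.
Proof. by move=> /andP[p0 p1]; rewrite /logit gt_eqF// lt_eqF. Qed.

(** The values of [sigma] at the infinities cover the endpoints, so degenerate success probabilities
    need no separate treatment later. *)
Lemma sigma_logit p : 0 <= p <= 1 -> sigma (logit p) = p.
Proof.
rewrite /logit => /andP[p0 p1].
have [->//|pn0] := eqVneq p 0; have [->//|pn1] := eqVneq p 1.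
have pgt0 : 0 < p by rewrite lt_neqAle eq_sym pn0.
have plt1 : 0 < 1 - p by rewrite subr_gt0 lt_neqAle pn1.
rewrite /= expRN lnK ?posrE ?divr_gt0//.
by field; rewrite !gt_eqF//=; lra.
Qed.

(** The normalizer cancels in the odds, which are multiplied by [u / v]; at the endpoints the
    infinite logit absorbs the finite shift. *)
Lemma logit_reweight s u v : 0 <= s <= 1 -> 0 < u -> 0 < v ->
  logit (s * u / (s * u + (1 - s) * v)) = (logit s + (ln (u / v))%:E)%E.
Proof.
move=> /andP[s0 s1] u0 v0.
have [->|sn0] := eqVneq s 0; first by rewrite /logit !mul0r eqxx.
have [->|sn1] := eqVneq s 1.
  by rewrite /logit subrr !mul0r mul1r addr0 divff ?lt0r_neq0// oner_eq0 eqxx.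
have sgt0 : 0 < s by rewrite lt_neqAle eq_sym sn0.
have slt1 : 0 < 1 - s by rewrite subr_gt0 lt_neqAle sn1.
have a0 : 0 < s * u by rewrite mulr_gt0.
have b0 : 0 < (1 - s) * v by rewrite mulr_gt0.
have ab0 : 0 < s * u + (1 - s) * v by rewrite addr_gt0.
rewrite !logit_fin; last 2 first.
- by rewrite sgt0 -subr_gt0.
- by rewrite divr_gt0//= ltr_pdivrMr// mul1r ltrDl.
rewrite -EFinD -lnM ?posrE ?divr_gt0//; congr (ln _)%:E.
have -> : 1 - s * u / (s * u + (1 - s) * v) =
    (1 - s) * v / (s * u + (1 - s) * v) by field; rewrite gt_eqF.
by field; rewrite !gt_eqF.
Qed.

Lemma increasing_cvg_logit (p : R^nat) c : 0 < c -> 0 < p 0%N < 1 ->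
  (forall n, 0 <= p n <= 1) ->
  (forall n, logit (p n) = (logit (p 0%N) + (n%:R * c)%:E)%E) ->
  increasing_seq p /\ p @ \oo --> (1 : R).
Proof.
move=> c0 p01 p_ge0_le1 logitp.
(* Inverting the logit gives [p n = 1 / (1 + a * z ^+ n)], with [a] the initial odds of failure and
   [z < 1] their decay factor per step. *)
set a := expR (- ln (p 0%N / (1 - p 0%N))); set z := expR (- c).
have pE n : p n = (1 + a * z ^+ n)^-1.
  rewrite -[LHS]sigma_logit// logitp logit_fin//= opprD expRD -mulrN.
  by rewrite expRM_natl.
have a0 : 0 < a by exact: expR_gt0.
have z0 : 0 < z by exact: expR_gt0.
have z1 : z < 1 by rewrite -expR0 ltr_expR oppr_lt0.
have az0 n : 0 < a * z ^+ n by rewrite mulr_gt0// exprn_gt0.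
split.
  apply/increasing_seqP => n; rewrite !pE ltf_pV2 ?posrE ?addr_gt0//.
  by rewrite ltrD2l ltr_pM2l// exprS gtr_pMl// exprn_gt0.
rewrite (_ : p = fun n => (1 + a * z ^+ n)^-1); last exact/funext.
rewrite -[X in _ --> X]invr1; apply: cvgV => //.
rewrite -[X in _ --> X]addr0; apply: cvgD; first exact: cvg_cst.
rewrite -(mulr0 a); apply: cvgM; first exact: cvg_cst.
by apply: cvg_expr; rewrite gtr0_norm.
Qed.

End logit.

(** * The one-step recursion and the two iterations *)

Lemma logit_update (R : realType) (dQ dO : measure_display)
    (Q : measurableType dQ) (O : measurableType dO)
    (rho : probability Q R) (mu : {sigma_finite_measure set O -> \bar R})
    (r : Q -> O -> bool)
    (mr : measurable_fun [set: Q * O] (fun x : Q * O => r x.1 x.2))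
    (beta : R) (beta_gt0 : 0 < beta) (anchor old new : policy Q mu) :
  update rho r beta anchor old new ->
  {ae rho, forall q,
    logit (success r new q) = (logit (success r anchor q) + (beta^-1)%:E)%E}.
Proof.
move=> /(success_update mr beta_gt0); apply: filterS => q ->.
rewrite success_tilted// logit_reweight ?weight_gt0//; last first.
  by rewrite success_ge0// success_le1.
congr (_ + _)%E; congr EFin.
(* The success probability of [old] cancels in the difference of the two exponents, leaving
   [1 / beta]. *)
rewrite ln_div ?posrE ?weight_gt0// /weight !expRK /=.
by field; rewrite gt_eqF.
Qed.

Theorem mainTheorem7 (R : realType) (dQ dO : measure_display)
    (Q : measurableType dQ) (O : measurableType dO)
    (rho : probability Q R) (mu : {sigma_finite_measure set O -> \bar R})
    (r : Q -> O -> bool)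
    (mr : measurable_fun [set: Q * O] (fun x : Q * O => r x.1 x.2))
    (beta : R) (beta_gt0 : 0 < beta)
    (piref : policy Q mu) (pi : nat -> policy Q mu) (pi0 : pi 0%N = piref) :
  let p := fun n q => success r (pi n) q in
  let pref := p 0%N in
  let pstar := fun q => sigma (logit (pref q) + (beta^-1)%:E)%E in
  ((forall n, (1 <= n)%N -> update rho r beta piref (pi n.-1) (pi n)) ->
     {ae rho, forall q, forall n, (1 <= n)%N ->
        logit (p n q) = (logit (pref q) + (beta^-1)%:E)%E}
     /\ {ae rho, forall q, forall n, (1 <= n)%N -> p n q = pstar q}
     /\ (forall old new : policy Q mu, update rho r beta piref old new ->
           {ae rho, forall q, success r old q = pstar q ->
                              success r new q = pstar q}))
  /\
  ((forall n, (1 <= n)%N -> update rho r beta (pi n.-1) (pi n.-1) (pi n)) ->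
     {ae rho, forall q, forall n, (1 <= n)%N ->
        logit (p n q) = (logit (p n.-1 q) + (beta^-1)%:E)%E}
     /\ {ae rho, forall q, forall n, (1 <= n)%N ->
        logit (p n q) = (logit (pref q) + (n%:R / beta)%:E)%E}
     /\ {ae rho, forall q, 0 < pref q < 1 ->
        increasing_seq (fun n => p n q) /\
        (fun n => p n q) @ \oo --> (1 : R)}).
Proof.
move=> p pref pstar.
have success01 (pol : policy Q mu) q : 0 <= success r pol q <= 1.
  by rewrite success_ge0// success_le1.
split=> opt.
- have logitp : {ae rho, forall q, forall n, (1 <= n)%N ->
      logit (p n q) = (logit (pref q) + (beta^-1)%:E)%E}.
    (* A countable union of null sets is null, so one exceptional set serves all [n]; at index 0 the
       condition [1 <= n] makes the claim vacuous. *)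
    apply: ae_foralln => -[|n]; first exact: aeW.
    have := logit_update mr beta_gt0 (opt n.+1 isT).
    by apply: filterS => q; rewrite -pi0.
  split=> //; split.
    apply: filterS logitp => q logitp n n1.
    rewrite /pstar -(logitp n n1) sigma_logit//; exact: success01.
  move=> old new /(logit_update mr beta_gt0); apply: filterS => q.
  by rewrite -pi0 /pstar /pref /p => <- _; rewrite sigma_logit.
- have step : {ae rho, forall q, forall n, (1 <= n)%N ->
      logit (p n q) = (logit (p n.-1 q) + (beta^-1)%:E)%E}.
    apply: ae_foralln => -[|n]; first exact: aeW.
    have := logit_update mr beta_gt0 (opt n.+1 isT).
    exact: filterS.
  have logitp : {ae rho, forall q, forall n,
      logit (p n q) = (logit (pref q) + (n%:R * beta^-1)%:E)%E}.
    (* The induction runs at a fixed prompt outside the single exceptional set of [step]. *)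
    apply: filterS step => q step; elim=> [|n IH].
      by rewrite mul0r adde0.
    by rewrite step//= IH -addeA -EFinD -natr1 mulrDl mul1r.
  split=> //; split; first by apply: filterS logitp => q + n _; exact.
  apply: filterS logitp => q logitp pref01.
  apply: (@increasing_cvg_logit _ _ beta^-1) => //; first by rewrite invr_gt0.
  by move=> n; exact: success01.
Qed.
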